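(* Let $$A_1=\begin{pmatrix}a_1&0\\ a_2&a_4\end{pmatrix},\quad A_2=\begin{pmatrix}\gamma_1&0\\ \gamma_2&a_4\end{pmatrix},\quad B=\begin{pmatrix}b_1\\ b_2\end{pmatrix}$$ be real matrices defining an unobservable planar bimodal linear system, let $C=(1\;\,0)$, and let $e\in M_{2\times 1}(\mathbb{R})$ be the matrix such that $eC=A_2-A_1$. Suppose that for all $\lambda\in\mathbb{R}$, all $v\in\mathbb{R}^2$ with $v\neq 0$, and all $\mu_1,\mu_2\in\mathbb{R}$, the equalities $$\begin{pmatrix}v^t&\mu_i\end{pmatrix}\begin{pmatrix}\lambda I_2-A_i&B\\ C&0\end{pmatrix}=0\quad\text{for both } i=1\text{ and } i=2$$ imply $\mu_1\mu_2>0$. Then the pair $(A_1,[B\,|\,e])$ is controllable.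
   Context: A planar bimodal linear system is given by a triple $(A_1,A_2,B)\in M_2(\mathbb{R})\times M_2(\mathbb{R})\times M_{2\times 1}(\mathbb{R})$ such that $A_1$ and $A_2$ have the same second column, together with $C=(1\;\,0)$. The system is observable if $\operatorname{rank}\begin{pmatrix}C\\ CA_i\end{pmatrix}=2$ for $i=1,2$, and unobservable otherwise; unobservability means exactly that the $(1,2)$ entry common to $A_1$ and $A_2$ is zero. Here $[B\,|\,e]$ is the $2\times 2$ matrix with columns $B$ and $e$, and a pair $(A,G)$ with $A\in M_2(\mathbb{R})$, $G\in M_{2\times 2}(\mathbb{R})$ is controllable if $\operatorname{rank}[G\,|\,AG]=2$. *)

(* Defs.v *)
From mathcomp Require Import all_boot all_order all_algebra.
From mathcomp Require Import reals.

Set Implicit Arguments.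
Unset Strict Implicit.
Unset Printing Implicit Defensive.

Import Order.TTheory GRing.Theory Num.Theory.
Local Open Scope ring_scope.

Definition mx22 (R : realType) (a b c d : R) : 'M[R]_2 :=
  \matrix_(i < 2, j < 2)
    if i == 0 then (if j == 0 then a else b) else (if j == 0 then c else d).

Definition cv2 (R : realType) (a b : R) : 'cV[R]_2 :=
  \col_(i < 2) if i == 0 then a else b.

Definition outC (R : realType) : 'rV[R]_2 :=
  \row_(j < 2) if j == 0 then 1 else 0.

(* Columns are indexed from 0, so [col 1] is the second column. *)
Record bimodal_system (R : realType) := BimodalSystem {
  sysA1 : 'M[R]_2;
  sysA2 : 'M[R]_2;
  sysB : 'cV[R]_2;
  sys_col2 : col 1 sysA1 = col 1 sysA2
}.

Definition observable (R : realType) (S : bimodal_system R) : Prop :=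
  \rank (col_mx (outC R) (outC R *m sysA1 S)) = 2%N /\
  \rank (col_mx (outC R) (outC R *m sysA2 S)) = 2%N.

Definition controllable (R : realType) (A G : 'M[R]_2) : Prop :=
  \rank (row_mx G (A *m G)) = 2%N.

Definition rosenbrock_mx (R : realType) (lambda : R) (A : 'M[R]_2)
    (B : 'cV[R]_2) : 'M[R]_(2 + 1) :=
  block_mx (lambda%:M - A) B (outC R) 0.

(* Main.v *)
(* If [b1 = 0] then [v = (1, 0)] and [lambda = a1] satisfy the equalities with
   [mu1 = 0], which is excluded.  A row [v] killing [B] and [A1 B] then has
   [lambda = a4] and [mu1 = v1 (a1 - a4) + v2 a2] as admissible data, and
   [b1 mu1 = v A1 B - a4 v B = 0] forces [mu1 = 0], so [v = 0].  Hence already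
   [B | A1 B] has rank 2. *)

Require Import Defs.
From mathcomp Require Import all_boot all_order all_algebra.
From mathcomp Require Import reals ring.

Set Implicit Arguments.
Unset Strict Implicit.
Unset Printing Implicit Defensive.

Import Order.TTheory GRing.Theory Num.Theory.
Local Open Scope ring_scope.

Lemma cv2_neq0 (R : realType) (x y : R) : (cv2 x y != 0) = (x != 0) || (y != 0).
Proof.
rewrite -negb_and; congr (~~ _); apply/eqP/andP => [/colP v0|[/eqP-> /eqP->]].
  by split; apply/eqP; [have := v0 0 | have := v0 1]; rewrite !mxE.
by apply/colP => i; rewrite !mxE if_same.
Qed.

Lemma rowE2 (R : realType) (v : 'rV[R]_2) : v = (cv2 (v 0 0) (v 0 1))^T.
Proof.
by apply/rowP => -[[|[|//]] jlt]; rewrite !mxE /=; congr (v 0 _); apply: val_inj.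
Qed.

Lemma mul_tr_cv2_eq0 (R : realType) (x y b1 b2 : R) :
  ((cv2 x y)^T *m cv2 b1 b2 == 0) = (x * b1 + y * b2 == 0).
Proof.
rewrite [_ *m _]mx11_scalar !mxE !big_ord_recl big_ord0 !mxE /= addr0.
apply/eqP/eqP => [/matrixP/(_ 0 0)|->]; last exact: raddf0.
by rewrite !mxE.
Qed.

Lemma mul_tr_cv2_mx22 (R : realType) (x y a b c d : R) :
  (cv2 x y)^T *m mx22 a b c d = (cv2 (x * a + y * c) (x * b + y * d))^T.
Proof.
by apply/rowP => j; rewrite !mxE !big_ord_recl big_ord0 !mxE /= addr0; case: ifP.
Qed.

(** The first column of the product determines [mu], since [C] is nonzero only there. The second
    column leaves the condition [y * (lambda - d) = 0], and the last one is [v B = 0]. *)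
Lemma rosenbrock_ker (R : realType) (lambda a c d b1 b2 x y : R) :
  y * (lambda - d) = 0 -> x * b1 + y * b2 = 0 ->
  row_mx (cv2 x y)^T (x * (a - lambda) + y * c)%:M
    *m rosenbrock_mx lambda (mx22 a 0 c d) (cv2 b1 b2) = 0.
Proof.
move=> yd /eqP; rewrite -mul_tr_cv2_eq0 => /eqP vb.
rewrite mul_row_block mulmx0 addr0 vb.
suff -> : (cv2 x y)^T *m (lambda%:M - mx22 a 0 c d) +
    (x * (a - lambda) + y * c)%:M *m outC R = 0 by rewrite row_mx0.
rewrite mulmxBr mul_mx_scalar mul_tr_cv2_mx22 mul_scalar_mx.
apply/rowP => j; rewrite !mxE; case: ifP => _; first by ring.
by rewrite -[RHS]yd; ring.
Qed.

Theorem corollary9 (R : realType) (S : bimodal_system R)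
    (a1 a2 a4 gamma1 gamma2 b1 b2 : R) (e : 'cV[R]_2)
    (hA1 : sysA1 S = mx22 a1 0 a2 a4)
    (hA2 : sysA2 S = mx22 gamma1 0 gamma2 a4)
    (hB : sysB S = cv2 b1 b2)
    (hunobs : ~ observable S)
    (he : e *m outC R = sysA2 S - sysA1 S)
    (hmu : forall (lambda : R) (v : 'cV[R]_2) (mu1 mu2 : R), v != 0 ->
       row_mx v^T mu1%:M *m rosenbrock_mx lambda (sysA1 S) (sysB S) = 0 ->
       row_mx v^T mu2%:M *m rosenbrock_mx lambda (sysA2 S) (sysB S) = 0 ->
       0 < mu1 * mu2) :
  controllable (sysA1 S) (row_mx (sysB S) e).
Proof.
(* Both modes share [a4] and [B], so the same [lambda] and [v] are admissible for both, each with
   its own [mu]; [mu1 = 0] would contradict [0 < mu1 * mu2]. *)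
have mu1_neq0 lambda x y : cv2 x y != 0 -> y * (lambda - a4) = 0 ->
    x * b1 + y * b2 = 0 -> x * (a1 - lambda) + y * a2 != 0.
  move=> v0 yl xb.
  have := hmu lambda (cv2 x y) (x * (a1 - lambda) + y * a2)
    (x * (gamma1 - lambda) + y * gamma2) v0.
  rewrite hA1 hA2 hB !rosenbrock_ker // => /(_ erefl erefl).
  by apply: contraTneq => ->; rewrite mul0r ltxx.
have b1_neq0 : b1 != 0.
  apply/eqP => b10; have := mu1_neq0 a1 1 0.
  rewrite cv2_neq0 oner_neq0 b10 subrr !(mulr0, mul0r, addr0) eqxx.
  by move=> /(_ isT erefl erefl).
have kerB x y : (cv2 x y)^T *m row_mx (cv2 b1 b2) e = 0 -> x * b1 + y * b2 = 0.
  rewrite mul_mx_row -[0]row_mx0 => /eq_row_mx[/eqP + _].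
  by rewrite mul_tr_cv2_eq0 => /eqP.
(* Rank 2 equals the number of rows, so it suffices that the left kernel is trivial. *)
apply/eqP/inj_row_free => v; rewrite [v]rowE2.
set x := v 0 0; set y := v 0 1 => /eqP.
rewrite hA1 hB mul_mx_row row_mx_eq0 mulmxA mul_tr_cv2_mx22.
move=> /andP[/eqP/kerB vB /eqP/kerB vAB].
apply/eqP; rewrite trmx_eq0; apply/negPn/negP => v0.
(* At [lambda = a4] the condition on [y] holds for every [y]. *)
have := mu1_neq0 a4 x y v0 _ vB; rewrite subrr mulr0 => /(_ erefl) /negP; apply.
rewrite -(mulIr_eq0 _ (mulIf b1_neq0)).
(* The second column of [A1 - a4 I] is zero, so [v (A1 - a4 I) = (mu1, 0)]; multiplying by [B] gives
   this identity. *)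
have -> : (x * (a1 - a4) + y * a2) * b1 =
    (x * a1 + y * a2) * b1 + (x * 0 + y * a4) * b2 - a4 * (x * b1 + y * b2).
  by ring.
by rewrite vAB vB mulr0 subr0.
Qed.
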